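(* Let $f:\mathbb{C}^2\to\mathbb{C}$ be a mixed polynomial with $f(0)=0$. If $f$ is inner non-degenerate (IND), then $f$ is partially non-degenerate (PND). If $f$ is strongly inner non-degenerate (SIND), then $f$ is strongly partially non-degenerate (SPND).
   Context: A mixed polynomial is a (not identically zero) finite sum $f(z,\bar z)=\sum_{\nu,\mu}c_{\nu,\mu}z^\nu\bar z^\mu$ with $z=(u,v)\in\mathbb{C}^2$, $\bar z=(\bar u,\bar v)$, $z^\nu=u^{\nu_1}v^{\nu_2}$, $\bar z^\mu=\bar u^{\mu_1}\bar v^{\mu_2}$. Its support is $\mathrm{supp}(f)=\{\nu+\mu: c_{\nu,\mu}\neq 0\}\subset\mathbb{N}^2$. $f_u,f_{\bar u},f_v,f_{\bar v}$ denote the (Wirtinger) partial derivatives. $V_f=f^{-1}(0)$. Singular set: put $s_{1,f}=f_u\overline{f_{\bar v}}-\overline{f_{\bar u}}f_v$, $s_{2,f}=|f_u|^2-|f_{\bar u}|^2$, $s_{3,f}=|f_v|^2-|f_{\bar v}|^2$ (these are mixed polynomials). The set of critical (singular) points of $f$ is $\Sigma_f=\{s_{1,f}=s_{2,f}=s_{3,f}=0\}$; it is the set of points where the real Jacobian matrix of $f$ does not have maximal rank. Face functions: a positive weight vector is $P=(p_1,p_2)$ with $p_1,p_2$ positive integers. The radial degree of a monomial $c_{\nu,\mu}z^\nu\bar z^\mu$ is $p_1(\nu_1+\mu_1)+p_2(\nu_2+\mu_2)$; $d(P;f)$ is the minimal radial degree among the monomials of $f$, and the face function $f_P$ is the sum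 of the monomials of $f$ of radial degree $d(P;f)$ (for the zero polynomial, the $P$-part is $0$). The Newton boundary $\Gamma_f$ is the union of the compact faces (vertices and 1-dimensional faces, ''1-faces'') of the convex hull of $\bigcup_{\nu+\mu\in\mathrm{supp}(f)}\left(\nu+\mu+\mathbb{R}_{\ge0}^2\right)$. For a compact face $\Delta$, $f_\Delta=\sum_{\nu+\mu\in\Delta}c_{\nu,\mu}z^\nu\bar z^\mu$, and $f_\Gamma=\sum_{\nu+\mu\in\Gamma_f}c_{\nu,\mu}z^\nu\bar z^\mu$. Let $P_1,\dots,P_N$ be the weight vectors (one for each 1-face) such that $f_{P_i}$ is the face function of a compact 1-face, with $P_i=(p_{i,1},p_{i,2})$ and $k_i=p_{i,1}/p_{i,2}$, ordered so that $k_1>k_2>\dots>k_N$. A vertex of $\Gamma_f$ is called extreme if it bounds a unique 1-face, and non-extreme if it bounds two. IND: (i) $f_{P_1}$ has no critical points in $V_{f_{P_1}}\cap(\mathbb{C}^2\setminus\{v=0\})$ and $f_{P_N}$ has no critical points in $V_{f_{P_N}}\cap(\mathbb{C}^2\setminus\{u=0\})$; (ii) for each 1-face and each non-extreme vertex $\Delta$, $f_\Delta$ has no critical points in $V_{f_\Delta}\cap(\mathbb{C}^* )^2$. SIND: (i) $f_{P_1}$ has no critical points in $\mathbb{C}^2\setminus\{v=0\}$ and $f_{P_N}$ has no critical points in $\mathbb{C}^2\setminus\{u=0\}$; (ii) for each 1-face and each non-extreme vertex $\Delta$, $f_\Delta$ has no critical points in $(\mathbb{C}^* )^2$. If $\Gamma_f$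 is a single vertex, $f$ is called SIND if $f_\Gamma$ has no critical points in $\mathbb{C}^2\setminus\{(0,0)\}$, and IND if $f_\Gamma$ has no critical points in $V_{f_\Gamma}\cap(\mathbb{C}^2\setminus\{(0,0)\})$. PND: for every positive weight vector $P$: (i) the system $(s_{1,f}(0,v))_P=(s_{2,f}(0,v))_P=(s_{3,f}(0,v))_P=(f(0,v))_P=0$ has no solution in $(\mathbb{C}^* )^2$, and the system $(s_{1,f}(u,0))_P=(s_{2,f}(u,0))_P=(s_{3,f}(u,0))_P=(f(u,0))_P=0$ has no solution in $(\mathbb{C}^* )^2$; (ii) the system $(s_{1,f})_P=(s_{2,f})_P=(s_{3,f})_P=f_P=0$ has no solution in $(\mathbb{C}^* )^2$. SPND: for every positive weight vector $P$: (i) the system $(s_{1,f}(0,v))_P=(s_{2,f}(0,v))_P=(s_{3,f}(0,v))_P=0$ has no solution in $(\mathbb{C}^* )^2$, and the system $(s_{1,f}(u,0))_P=(s_{2,f}(u,0))_P=(s_{3,f}(u,0))_P=0$ has no solution in $(\mathbb{C}^* )^2$; (ii) the system $(s_{1,f})_P=(s_{2,f})_P=(s_{3,f})_P=0$ has no solution in $(\mathbb{C}^* )^2$. Here $h(0,v)$ and $h(u,0)$ denote the mixed polynomials obtained from $h$ by setting $u=\bar u=0$, respectively $v=\bar v=0$. *)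

(* Defs.v *)
From mathcomp Require Import all_boot all_order all_algebra.
From mathcomp Require Import boolp classical_sets reals topology convex.
From mathcomp Require Import complex mpoly.

Set Implicit Arguments.
Unset Strict Implicit.
Unset Printing Implicit Defensive.

Import Order.TTheory GRing.Theory Num.Theory.
Import numFieldTopology.Exports.

Local Open Scope classical_set_scope.
Local Open Scope ring_scope.

(* A mixed polynomial in z = (u, v) and its conjugate is a polynomial in four
   formal variables, numbered in the order u, v, \bar u, \bar v.  The
   coefficients of the expansion are determined by the function (u, v) |->
   f(z, \bar z), so that f is identically zero iff the formal polynomial is. *)
Notation mixed R := {mpoly R[i][4]}.

Definition iu : 'I_4 := @Ordinal 4 0 isT.
Definition iv : 'I_4 := @Ordinal 4 1 isT.
Definition iub : 'I_4 := @Ordinal 4 2 isT.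
Definition ivb : 'I_4 := @Ordinal 4 3 isT.

Section MixedPolynomials.
Variable R : realType.
Implicit Types (f h : mixed R) (u v : R[i]) (m : 'X_{1..4}) (P : nat * nat).

Definition mixed_eval f u v : R[i] := f.@[tnth [tuple u; v; u^*; v^*]].

Definition mixed_conj f : mixed R :=
  map_mpoly (Num.conj : R[i] -> R[i]) f
    \mPo [tuple 'X_iub; 'X_ivb; 'X_iu; 'X_iv].

(* |f|^2 as a mixed polynomial. *)
Definition mixed_sqnorm f : mixed R := f * mixed_conj f.

(* The Wirtinger derivatives are the formal ones, the conjugate variables being
   treated as independent. *)
Definition s1 f : mixed R :=
  f^`M(iu) * mixed_conj f^`M(ivb) - mixed_conj f^`M(iub) * f^`M(iv).
Definition s2 f : mixed R := mixed_sqnorm f^`M(iu) - mixed_sqnorm f^`M(iub).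
Definition s3 f : mixed R := mixed_sqnorm f^`M(iv) - mixed_sqnorm f^`M(ivb).

Definition critical f u v : Prop :=
  [/\ mixed_eval (s1 f) u v = 0,
      mixed_eval (s2 f) u v = 0 &
      mixed_eval (s3 f) u v = 0].

(* h(0, v) and h(u, 0). *)
Definition restr_u0 h : mixed R := h \mPo [tuple 0; 'X_iv; 0; 'X_ivb].
Definition restr_v0 h : mixed R := h \mPo [tuple 'X_iu; 0; 'X_iub; 0].

Definition positive_weight P : Prop := (0 < P.1)%N /\ (0 < P.2)%N.

Definition radial_deg P m : nat :=
  (P.1 * (m iu + m iub) + P.2 * (m iv + m ivb))%N.

(* mlead f belongs to msupp f when f != 0, so that it only serves as a neutral
   default value of the minimum. *)
Definition min_radial_deg P f : nat :=
  \big[minn/radial_deg P (mlead f)]_(m <- msupp f) radial_deg P m.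

Definition face_fun P f : mixed R :=
  \sum_(m <- msupp f | radial_deg P m == min_radial_deg P f) f@_m *: 'X_[m].

(* The point nu + mu of the plane. *)
Definition expo m : 'rV[R]_2 :=
  \row_(i < 2) (if i == ord0 then m iu + m iub else m iv + m ivb)%N%:R.

Definition convex_hull (A : set 'rV[R]_2) : set 'rV[R]_2 :=
  smallest (@convex_set R 'rV[R]_2) A.

Definition newton_polygon f : set 'rV[R]_2 :=
  convex_hull
    [set x | exists2 m, m \in msupp f & forall i, expo m 0 i <= x 0 i].

(* The faces of a convex polyhedron K are the nonempty sets of minimizers on K
   of a linear form; w = 0 gives K itself. *)
Definition is_face (K F : set 'rV[R]_2) : Prop :=
  F !=set0 /\
  exists w : 'rV[R]_2,
    F = [set x | K x /\ forall y, K y ->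
           \sum_i w 0 i * x 0 i <= \sum_i w 0 i * y 0 i].

Definition compact_face f (F : set 'rV[R]_2) : Prop :=
  is_face (newton_polygon f) F /\ compact F.

Definition newton_boundary f : set 'rV[R]_2 :=
  \bigcup_(F in compact_face f) F.

Definition dim1 (F : set 'rV[R]_2) : Prop :=
  exists x y, [/\ x != y, F x, F y &
    forall z, F z -> exists t : R, z = x + t *: (y - x)].

Definition one_face f F : Prop := compact_face f F /\ dim1 F.

Definition vertex f (x : 'rV[R]_2) : Prop := compact_face f [set x].

Definition nonextreme_vertex f x : Prop :=
  vertex f x /\
  exists F1 F2, [/\ one_face f F1, one_face f F2, F1 <> F2, F1 x & F2 x].

Definition part_on f (F : set 'rV[R]_2) : mixed R :=
  \sum_(m <- msupp f | expo m \in F) f@_m *: 'X_[m].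

Definition gamma_part f : mixed R := part_on f (newton_boundary f).

Definition one_face_weight f P : Prop :=
  positive_weight P /\ exists2 F, one_face f F & face_fun P f = part_on f F.

Definition slope P : rat := P.1%:R / P.2%:R.

(* P_1 and P_N.  The weight vector of a 1-face is determined up to a positive
   factor, which changes neither its slope nor its face function. *)
Definition first_weight f P : Prop :=
  one_face_weight f P /\
  forall Q, one_face_weight f Q -> slope Q <= slope P.
Definition last_weight f P : Prop :=
  one_face_weight f P /\
  forall Q, one_face_weight f Q -> slope P <= slope Q.

Definition single_vertex f : Prop := exists x, newton_boundary f = [set x].

Definition IND f : Prop :=
  (single_vertex f ->
     forall u v, (u, v) != (0, 0) ->
       ~ (mixed_eval (gamma_part f) u v = 0 /\ critical (gamma_part f) u v)) /\
  (~ single_vertex f ->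
   [/\ forall P, first_weight f P -> forall u v, v != 0 ->
         ~ (mixed_eval (face_fun P f) u v = 0 /\ critical (face_fun P f) u v),
       forall P, last_weight f P -> forall u v, u != 0 ->
         ~ (mixed_eval (face_fun P f) u v = 0 /\ critical (face_fun P f) u v),
       forall F, one_face f F -> forall u v, u != 0 -> v != 0 ->
         ~ (mixed_eval (part_on f F) u v = 0 /\ critical (part_on f F) u v) &
       forall x, nonextreme_vertex f x -> forall u v, u != 0 -> v != 0 ->
         ~ (mixed_eval (part_on f [set x]) u v = 0 /\
            critical (part_on f [set x]) u v)]).

Definition SIND f : Prop :=
  (single_vertex f ->
     forall u v, (u, v) != (0, 0) -> ~ critical (gamma_part f) u v) /\
  (~ single_vertex f ->
   [/\ forall P, first_weight f P -> forall u v, v != 0 ->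
         ~ critical (face_fun P f) u v,
       forall P, last_weight f P -> forall u v, u != 0 ->
         ~ critical (face_fun P f) u v,
       forall F, one_face f F -> forall u v, u != 0 -> v != 0 ->
         ~ critical (part_on f F) u v &
       forall x, nonextreme_vertex f x -> forall u v, u != 0 -> v != 0 ->
         ~ critical (part_on f [set x]) u v]).

Definition common_zero_of_P_parts P (hs : seq (mixed R)) u v : Prop :=
  forall h, h \in hs -> mixed_eval (face_fun P h) u v = 0.

Definition PND f : Prop :=
  forall P, positive_weight P -> forall u v, u != 0 -> v != 0 ->
  [/\ ~ common_zero_of_P_parts P
          [:: restr_u0 (s1 f); restr_u0 (s2 f); restr_u0 (s3 f); restr_u0 f]
          u v,
      ~ common_zero_of_P_parts P
          [:: restr_v0 (s1 f); restr_v0 (s2 f); restr_v0 (s3 f); restr_v0 f]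
          u v &
      ~ common_zero_of_P_parts P [:: s1 f; s2 f; s3 f; f] u v].

Definition SPND f : Prop :=
  forall P, positive_weight P -> forall u v, u != 0 -> v != 0 ->
  [/\ ~ common_zero_of_P_parts P
          [:: restr_u0 (s1 f); restr_u0 (s2 f); restr_u0 (s3 f)] u v,
      ~ common_zero_of_P_parts P
          [:: restr_v0 (s1 f); restr_v0 (s2 f); restr_v0 (s3 f)] u v &
      ~ common_zero_of_P_parts P [:: s1 f; s2 f; s3 f] u v].

End MixedPolynomials.

(* Main.v *)
Require Import Defs.
From mathcomp Require Import all_boot all_order all_algebra.
From mathcomp Require Import reals complex mpoly.
From mathcomp Require Import boolp classical_sets topology normedtype convex.
From mathcomp Require Import interval_inference ring lra zify.

(** The proof turns a common zero of the P-parts into a degenerate point of a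
    face function of f to which inner nondegeneracy applies.  Two observations
    on P-parts do this.

    The polynomials s_i are homogeneous expressions in the derivatives of f and
    their conjugates, so s_i(f_P) is either the P-part of s_i(f) or zero.  Zeros
    of the P-parts of s_1(f), s_2(f), s_3(f) are thus critical points of f_P
    ([critical_face]).  This settles every P for which f_P belongs to a 1-face
    or to a non-extreme vertex.

    If f_P belongs to an extreme vertex, say the leftmost one, then P has larger
    slope than the weight Q of the first 1-face.  For any h, if h_Q has terms in
    v alone then h_P is the sum of these terms; so a zero (u, v) of h_P gives the
    zero (0, v) of h_Q ([face_zero_u0]).  With h = s_i(f) and h = f, and with the
    first observation for Q, the point (0, v) is degenerate for f_Q, which
    has no degenerate points off {v = 0}.  This passes through the P-parts of
    s_i(f) rather than through s_i(f_P), which may vanish identically when the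
    P-part does not.  The systems on the axes are treated in the same way: the
    P-part of h(0, v) is h_Q(0, v) unless the latter vanishes identically, for
    all P and Q ([restr_u0_face_zero]).

    The rest is the geometry of the Newton polygon.  Compact faces are exactly
    the sets of minimizers of positive linear forms, and they are segments
    between points of the support, which makes 1-faces and their weights
    combinatorial ([one_face_weightP]).  Rotating a weight that selects a single
    vertex until a second point ties with it ([tilted_tie]) decides whether the
    vertex is extreme, non-extreme or the only one ([nondegenerate_faces]). *)

Set Implicit Arguments.
Unset Strict Implicit.
Unset Printing Implicit Defensive.

Import Order.TTheory GRing.Theory Num.Theory.
Import numFieldNormedType.Exports.
Local Open Scope classical_set_scope.
Local Open Scope ring_scope.

(** * Convex hulls and faces of the Newton polygon *)

Section Geometry.
Variable R : realType.
Implicit Types (f : mixed R) (x y z w : 'rV[R]_2) (A C K : set 'rV[R]_2).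

Lemma hull_ind A C :
    (forall x y t, 0 <= t -> t <= 1 -> C x -> C y -> C (t *: x + (1 - t) *: y)) ->
  A `<=` C -> convex_hull A `<=` C.
Proof.
move=> convC AC; apply: smallest_sub => // x y t; rewrite !inE => Cx Cy.
by apply: convC.
Qed.

Lemma hull_conv A x y t : 0 <= t -> t <= 1 ->
  convex_hull A x -> convex_hull A y -> convex_hull A (t *: x + (1 - t) *: y).
Proof.
move=> t0 t1 Ax Ay C [convC AC].
have := convC x y (Itv01 t0 t1); rewrite !inE; apply.
- exact: Ax.
- exact: Ay.
Qed.

Lemma sum_ord2 (F : 'I_2 -> R) : \sum_i F i = F ord0 + F ord_max.
Proof.
rewrite big_ord_recr big_ord_recr big_ord0 /= add0r.
by congr (F _ + _); apply: val_inj.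
Qed.

Lemma ord2P (i : 'I_2) : i = ord0 \/ i = ord_max.
Proof. by case: i => [[|[|i]] lti] //; [left|right]; apply: val_inj. Qed.

Lemma rV2P x y : x 0 ord0 = y 0 ord0 -> x 0 ord_max = y 0 ord_max -> x = y.
Proof. by move=> e0 e1; apply/rowP => i; case: (ord2P i) => ->. Qed.

Definition abscissa (m : 'X_{1..4}) : nat := (m iu + m iub)%N.
Definition ordinate (m : 'X_{1..4}) : nat := (m iv + m ivb)%N.

Lemma expo0 m : expo R m 0 ord0 = (abscissa m)%:R.
Proof. by rewrite mxE. Qed.

Lemma expo1 m : expo R m 0 ord_max = (ordinate m)%:R.
Proof. by rewrite mxE. Qed.

Lemma expo_polygon f m : m \in msupp f -> newton_polygon f (expo R m).
Proof. by move=> mf C [_]; apply; exists m. Qed.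

(** Adding a fixed nonnegative vector sends the generators of the polygon to
    generators, so the points that stay in the polygon under every such
    translation form a convex set containing the generators. *)
Lemma polygon_up f x y : newton_polygon f x ->
  (forall i, x 0 i <= y 0 i) -> newton_polygon f y.
Proof.
move=> Kx xy.
pose C : set 'rV[R]_2 :=
  [set z | forall d : 'rV[R]_2, (forall i, 0 <= d 0 i) -> newton_polygon f (z + d)].
suff /(_ x Kx (y - x)) : newton_polygon f `<=` C.
  by rewrite subrKC; apply=> i; rewrite !mxE subr_ge0.
apply: hull_ind => [a b t t0 t1 Ca Cb d d0|a [m mf ma] d d0].
  have -> : t *: a + (1 - t) *: b + d = t *: (a + d) + (1 - t) *: (b + d).
    by apply/rowP => i; rewrite !mxE; ring.
  by apply: hull_conv => //; [apply: Ca|apply: Cb].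
apply: sub_gen_smallest; exists m => // i; rewrite [leRHS]mxE.
by rewrite (le_trans (ma i)) // lerDl.
Qed.

(** The set of minimizers is spelled as in the definition of a face, so that
    the two are convertible. *)
Definition minimizers K w : set 'rV[R]_2 :=
  [set x | K x /\ forall y, K y ->
           \sum_i w 0 i * x 0 i <= \sum_i w 0 i * y 0 i].

Definition positive_form w : Prop := 0 < w 0 ord0 /\ 0 < w 0 ord_max.

Lemma polygon_ge f w (c : R) : positive_form w ->
    (forall m, m \in msupp f -> c <= \sum_i w 0 i * expo R m 0 i) ->
  forall x, newton_polygon f x -> c <= \sum_i w 0 i * x 0 i.
Proof.
move=> [w0 w1] cf; apply: hull_ind => [x y t t0 t1 /=|x [m mf mx] /=].
  by rewrite !sum_ord2 !mxE; nra.
apply: (le_trans (cf _ mf)); rewrite !sum_ord2.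
by apply: lerD; rewrite ler_pM2l.
Qed.

Definition segment x y : set 'rV[R]_2 :=
  [set t *: x + (1 - t) *: y | t in `[0, 1]%classic].

Lemma segmentl x y : segment x y x.
Proof.
by exists 1; rewrite /= ?in_itv /= ?lexx ?ler01 // scale1r subrr scale0r addr0.
Qed.

Lemma segmentr x y : segment x y y.
Proof.
by exists 0; rewrite /= ?in_itv /= ?lexx ?ler01 // scale0r add0r subr0 scale1r.
Qed.

Lemma segmentxx x : segment x x = [set x].
Proof.
apply/seteqP; split=> [_ [t _ <-]|_ ->]; last exact: segmentl.
by rewrite /= -scalerDl subrKC scale1r.
Qed.

Lemma compact_rVsegment x y : compact (segment x y).
Proof.
apply: continuous_compact; last exact: segment_compact.
apply: continuous_subspaceT => t.
apply: (@cvgD _ _ _ _ _ (fun t : R => t *: x) (fun t : R => (1 - t) *: y)).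
  exact: scalel_continuous.
apply: cvgZr_tmp; apply: cvgB; [exact: cvg_cst|exact: cvg_id].
Qed.

(** Let [c] be the minimum of the form on the support.  The points where the
    form exceeds [c], together with those where it equals [c] and whose
    abscissa lies between those of [a] and [b], form a convex set containing
    all generators; hence it contains the polygon, and a minimizer, which lies
    on the line where the form is [c], must be between [a] and [b]. *)
Lemma minimizers_segment f w a b : positive_form w ->
    a \in msupp f -> b \in msupp f ->
    \sum_i w 0 i * expo R a 0 i = \sum_i w 0 i * expo R b 0 i ->
    (forall m, m \in msupp f ->
      \sum_i w 0 i * expo R a 0 i <= \sum_i w 0 i * expo R m 0 i) ->
    (forall m, m \in msupp f ->
      \sum_i w 0 i * expo R m 0 i = \sum_i w 0 i * expo R a 0 i ->
      (abscissa a <= abscissa m <= abscissa b)%N) ->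
  minimizers (newton_polygon f) w = segment (expo R a) (expo R b).
Proof.
move=> wpos af bf wab wa edge; set c := \sum_i w 0 i * expo R a 0 i in wab wa edge.
have [w0 w1] := wpos.
apply/seteqP; split=> [z [Kz minz]|z [t /=]]; last first.
  rewrite in_itv /= => /andP[t0 t1] <-; split.
    by apply: hull_conv => //; apply: expo_polygon.
  move=> y Ky; apply: le_trans (polygon_ge wpos wa Ky).
  have -> : \sum_i w 0 i * (t *: expo R a + (1 - t) *: expo R b) 0 i =
      t * c + (1 - t) * (\sum_i w 0 i * expo R b 0 i).
    by rewrite /c !sum_ord2 !mxE; ring.
  by rewrite -wab; lra.
pose C : set 'rV[R]_2 := [set z | c <= \sum_i w 0 i * z 0 i /\
  (\sum_i w 0 i * z 0 i <= c -> (abscissa a)%:R <= z 0 ord0 <= (abscissa b)%:R)].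
have KC : newton_polygon f `<=` C.
  apply: hull_ind => [x y t t0 t1 [cx Cx] [cy Cy]|x [m mf mx]] /=.
    have lin : \sum_i w 0 i * (t *: x + (1 - t) *: y) 0 i =
        t * (\sum_i w 0 i * x 0 i) + (1 - t) * (\sum_i w 0 i * y 0 i).
      by rewrite !sum_ord2 !mxE; ring.
    rewrite /C /mkset lin; split; first by nra.
    rewrite !mxE => le_c.
    (* At an end point only one of the two abscissa bounds is available; strictly
       inside, the value [c] forces both x and y onto the line. *)
    have [t00|tn0] := eqVneq t 0.
      rewrite t00 !(mul0r, add0r, subr0, mul1r) in le_c *.
      exact: Cy.
    have [t11|tn1] := eqVneq t 1.
      rewrite t11 subrr !(mul0r, addr0, mul1r) in le_c *.
      exact: Cx.
    have {t0 tn0} t0 : 0 < t by rewrite lt_neqAle eq_sym tn0.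
    have {t1 tn1} t1 : t < 1 by rewrite lt_neqAle tn1.
    have /Cx /andP[x1 x2] : \sum_i w 0 i * x 0 i <= c by nra.
    have /Cy /andP[y1 y2] : \sum_i w 0 i * y 0 i <= c by nra.
    by apply/andP; split; nra.
  have mxw : \sum_i w 0 i * expo R m 0 i <= \sum_i w 0 i * x 0 i.
    by rewrite !sum_ord2; apply: lerD; rewrite ler_pM2l.
  rewrite /C /mkset; split=> [|xc]; first exact: le_trans (wa _ mf) mxw.
  have mc : \sum_i w 0 i * expo R m 0 i = c.
    by apply/le_anti; rewrite wa // (le_trans mxw xc).
  have -> : x 0 ord0 = (abscissa m)%:R.
    rewrite -expo0; have := mx ord0; have := mx ord_max.
    move: xc; rewrite -mc !sum_ord2; nra.
  by rewrite !ler_nat; apply: edge.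
have [cz Cz] := KC _ Kz.
have zc : \sum_i w 0 i * z 0 i <= c by apply: minz; apply: expo_polygon.
have {Cz} /andP[az zb] := Cz zc.
have {cz zc} zc : \sum_i w 0 i * z 0 i = c by apply/le_anti; rewrite zc cz.
move: wab zc; rewrite /c !sum_ord2 !expo0 !expo1 => wab zc.
have w1n : w 0 ord_max != 0 by rewrite gt_eqF.
have [ab|ab] := eqVneq (abscissa a) (abscissa b).
  exists 1; rewrite /= ?in_itv /= ?ler01 ?lexx // subrr scale0r addr0 scale1r.
  have z0 : z 0 ord0 = (abscissa a)%:R by apply/le_anti; rewrite az {1}ab zb.
  apply: rV2P; rewrite ?expo0 ?expo1 ?z0 //.
  by apply: (mulfI w1n); move: zc; rewrite z0 => /addrI.
have ab0 : (abscissa b)%:R - (abscissa a)%:R != 0 :> R.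
  by rewrite subr_eq0 eqr_nat eq_sym.
have abp : 0 < (abscissa b)%:R - (abscissa a)%:R :> R.
  by rewrite lt_neqAle eq_sym ab0 subr_ge0 (le_trans az zb).
pose t : R := ((abscissa b)%:R - z 0 ord0) / ((abscissa b)%:R - (abscissa a)%:R).
have tz : t * ((abscissa b)%:R - (abscissa a)%:R) = (abscissa b)%:R - z 0 ord0.
  by rewrite /t divfK.
exists t; last first.
  apply: rV2P; rewrite !mxE.
    rewrite -/(abscissa a) -/(abscissa b); lra.
  rewrite -/(ordinate a) -/(ordinate b).
  apply: (mulfI w1n).
  have := congr1 ( *%R (1 - t)) wab; have := congr1 ( *%R (w 0 ord0)) tz; lra.
rewrite /= in_itv /=; apply/andP; split; rewrite /t.
  by rewrite divr_ge0 // ?subr_ge0 // -subr_ge0 ltW.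
by rewrite ler_pdivrMr // mul1r lerD2l lerN2.
Qed.

(** The polygon is stable under moving in the coordinate directions.  Existence
    of a minimizer thus forces nonnegative weights, and a zero weight would put
    a whole half-line into the face. *)
Lemma compact_face_positive f w (F := minimizers (newton_polygon f) w) :
  F !=set0 -> compact F -> positive_form w.
Proof.
move=> [y [Ky miny]] Fc.
have wi i : 0 < w 0 i.
  have up (t : R) : 0 <= t -> newton_polygon f (y + t *: delta_mx 0 i).
    move=> t0; apply: (polygon_up Ky) => j; rewrite !mxE eqxx /=.
    by rewrite lerDl mulr_ge0.
  have wup (t : R) : \sum_j w 0 j * (y + t *: delta_mx 0 i) 0 j =
      \sum_j w 0 j * y 0 j + t * w 0 i.
    by rewrite !sum_ord2 !mxE; case: (ord2P i) => -> /=; ring.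
  have /miny := up _ ler01; rewrite wup mul1r lerDl le_eqVlt => /orP[/eqP w0|//].
  pose g (x : 'rV[R]_2) := x 0 i.
  have /compact_bounded : compact (g @` F).
    apply: continuous_compact => //; apply: continuous_subspaceT.
    exact: coord_continuous.
  move=> [M [Mreal /(_ (`|M| + 1))]]; rewrite (le_lt_trans (ler_norm M)) ?ltrDl //.
  move=> /(_ isT) bnd.
  exfalso.
  (* |M| + 1 bounds the i-th coordinate on F, so this shift leaves the bound. *)
  pose t : R := `|M| + 2 + `|y 0 i|.
  have t0 : 0 <= t by rewrite /t !addr_ge0.
  have : `|g (y + t *: delta_mx 0 i)| <= `|M| + 1.
    apply: bnd; exists (y + t *: delta_mx 0 i) => //; split; first exact: up.
    by move=> z Kz; rewrite wup -w0 mulr0 addr0; apply: miny.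
  rewrite /g !mxE !eqxx mulr1 => /ler_normlP[_].
  have := ler_norm (- y 0 i); rewrite normrN /t; lra.
by split.
Qed.
End Geometry.

(** * Ties between points of a finite planar set *)

Lemma exists_seq_min (T : eqType) d (U : orderType d) (g : T -> U) (s : seq T) a0 :
  a0 \in s -> exists2 a, a \in s & forall b, b \in s -> (g a <= g b)%O.
Proof.
elim: s a0 => // c s IH a0 _; case: s IH => [_|c' s IH].
  by exists c; rewrite ?mem_seq1 // => b; rewrite mem_seq1 => /eqP->.
have [a ain amin] := IH c' (mem_head _ _).
have [ca|ac] := leP (g c) (g a).
  exists c; first exact: mem_head.
  move=> b; rewrite inE => /orP[/eqP-> //|bs]; exact: le_trans ca (amin b bs).
exists a; first by rewrite inE ain orbT.
by move=> b; rewrite inE => /orP[/eqP->|/amin //]; exact: ltW.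
Qed.

Section Ties.
Local Open Scope nat_scope.
Variables (T : eqType) (s : seq T) (x y : T -> nat).

Definition weighted_min p q a : Prop :=
  a \in s /\ forall b, b \in s -> p * x a + q * y a <= p * x b + q * y b.

(** Increase the weight of [x] continuously: the value at [a] grows faster than
    at every point to its left, so some left point eventually ties with [a].
    The first tie occurs at the least ratio of value gap to horizontal
    distance; clearing denominators gives integer weights, and before the first
    tie [a] stays minimal. *)
Lemma tilted_tie p q a b : 0 < p -> 0 < q -> weighted_min p q a ->
    (forall c, weighted_min p q c -> x c = x a) -> b \in s -> x b < x a ->
  exists p' q', [/\ 0 < p', 0 < q', p * q' < p' * q, weighted_min p' q' a &
    exists2 c, weighted_min p' q' c & x c < x a].
Proof.
move=> p0 q0 [ain amin] auniq bin ba.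
pose gap c := (p * x c + q * y c) - (p * x a + q * y a).
pose t c : rat := (gap c)%:R / (x a - x c)%:R.
(* t c is the amount to add to p, keeping q, for c to tie with a. *)
have bleft : b \in [seq c <- s | x c < x a] by rewrite mem_filter ba.
have [c] := exists_seq_min t bleft; rewrite mem_filter => /andP[ca cin] cmin.
have gap0 : 0 < gap c.
  rewrite subn_gt0 ltnNge; apply/negP => cle.
  have /auniq : weighted_min p q c by split=> // e /amin; apply: leq_trans.
  by move: ca => /[swap] ->; rewrite ltnn.
have min' e : e \in s ->
    ((x a - x c) * p + gap c) * x a + (x a - x c) * q * y a <=
    ((x a - x c) * p + gap c) * x e + (x a - x c) * q * y e.
  move=> ein; have := amin e ein.
  have [ae|ea] := leqP (x a) (x e).
    by move: ae gap0 ca; clear; nia.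
  have : e \in [seq c <- s | x c < x a] by rewrite mem_filter ea.
  move=> /cmin; rewrite /t ler_pdivrMr ?ltr0n ?subn_gt0 // mulrAC.
  rewrite ler_pdivlMr ?ltr0n ?subn_gt0 // -!natrM ler_nat.
  move=> cross ge; rewrite /gap in cross *.
  have := amin c cin; move: ca ea ge cross gap0; rewrite /gap; clear; nia.
exists ((x a - x c) * p + gap c), ((x a - x c) * q); split.
- by rewrite addn_gt0 gap0 orbT.
- by rewrite muln_gt0 subn_gt0 ca.
- by move: gap0 ca p0 q0; clear; nia.
- by split.
exists c => //; split=> // e ein; apply: leq_trans (min' e ein).
have := amin c cin; rewrite /gap; move: ca; clear; nia.
Qed.

End Ties.

(** * Faces selected by integer weights *)

Section Faces.
Variable R : realType.
Implicit Types (f h : mixed R) (w : 'rV[R]_2) (P Q : nat * nat) (m : 'X_{1..4}).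

Lemma mcoeff_filter h (c : pred 'X_{1..4}) m :
  (\sum_(k <- msupp h | c k) h@_k *: 'X_[k])@_m = if c m then h@_m else 0.
Proof.
rewrite raddf_sum /= -big_filter.
under eq_bigr do rewrite mcoeffZ mcoeffX.
have [|] := boolP (m \in [seq k <- msupp h | c k]).
  move=> min; rewrite (bigD1_seq m) ?filter_uniq ?msupp_uniq //= eqxx mulr1 big1.
    by move: min; rewrite mem_filter => /andP[-> _]; rewrite addr0.
  by move=> k /negPf->; rewrite mulr0.
move=> mout; rewrite big_seq big1 => [|k kin]; last first.
  by case: eqVneq mout => [<-|]; rewrite ?kin ?mulr0.
by move: mout; rewrite mem_filter negb_and mcoeff_msupp negbK => /orP[/negPf->|/eqP->]; rewrite ?if_same.
Qed.

Lemma mcoeff_face P f m : (face_fun P f)@_m =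
  if radial_deg P m == min_radial_deg P f then f@_m else 0.
Proof. exact: mcoeff_filter. Qed.

Lemma mcoeff_part f (F : set 'rV[R]_2) m : (part_on f F)@_m =
  if expo R m \in F then f@_m else 0.
Proof. exact: mcoeff_filter. Qed.

Definition minimal_mono P f m : Prop :=
  weighted_min (msupp f) abscissa ordinate P.1 P.2 m.

Lemma min_radial_deg_le P f m :
  m \in msupp f -> (min_radial_deg P f <= radial_deg P m)%N.
Proof.
rewrite /min_radial_deg; elim: (msupp f) => // k s IH.
rewrite inE big_cons => /orP[/eqP->|/IH]; first exact: geq_minl.
exact: leq_trans (geq_minr _ _).
Qed.

Lemma min_radial_deg_attained P f : f != 0 ->
  exists2 m, m \in msupp f & min_radial_deg P f = radial_deg P m.
Proof.
move=> f0; rewrite /min_radial_deg big_seq.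
elim/big_ind: _ => [|_ _ [m mf ->] [k kf ->]|m mf]; last by exists m.
  by exists (mlead f); rewrite ?mlead_supp.
by case: leqP => _; [exists m|exists k].
Qed.

Lemma minimal_monoP P f m :
  minimal_mono P f m <->
  m \in msupp f /\ radial_deg P m = min_radial_deg P f.
Proof.
split=> [[mf mmin]|[mf mdeg]].
  split=> //; apply/eqP; rewrite eqn_leq min_radial_deg_le // andbT.
  have f0 : f != 0 by apply: contraTneq mf => ->; rewrite msupp0.
  by have [k kf ->] := min_radial_deg_attained P f0; apply: mmin.
split=> // k kf; rewrite -/(radial_deg P k) -/(radial_deg P m) mdeg.
exact: min_radial_deg_le.
Qed.

Lemma msupp_face_fun P f m : (m \in msupp (face_fun P f)) <-> minimal_mono P f m.
Proof.
rewrite minimal_monoP mcoeff_msupp mcoeff_face mcoeff_msupp.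
case: (radial_deg P m =P _) => [->|ne]; first by split=> [mf|[]].
by rewrite eqxx; split=> // -[_ /ne].
Qed.

(** Among the minimal points of the support, take the leftmost and the
    rightmost. *)
Lemma minimizers_is_segment f w : f != 0 -> positive_form w ->
  exists a b, [/\ a \in msupp f, b \in msupp f &
    minimizers (newton_polygon f) w = segment (expo R a) (expo R b)].
Proof.
move=> f0 wpos.
pose g m := \sum_i w 0 i * expo R m 0 i.
have [c cin cmin] := exists_seq_min g (mlead_supp f0).
pose s := [seq m <- msupp f | g m == g c].
have cs : c \in s by rewrite mem_filter eqxx.
have [a] := exists_seq_min abscissa cs; rewrite mem_filter => /andP[/eqP ga ain] amin.
(* The rightmost point is the least one for the dual order. *)
have [b] := @exists_seq_min _ _ nat^d (abscissa : _ -> nat^d) _ _ cs.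
rewrite mem_filter => /andP[/eqP gb bin] bmax.
exists a, b; split=> //; apply: minimizers_segment => //.
- by rewrite -/(g a) -/(g b) ga gb.
- by move=> m mf; rewrite -/(g a) -/(g m) ga; apply: cmin.
move=> m mf; rewrite -/(g m) -/(g a) ga => gm.
have ms : m \in s by rewrite mem_filter gm eqxx.
by apply/andP; split; [apply: amin|apply: bmax].
Qed.

Lemma dim1_segment (a b : 'rV[R]_2) : dim1 (segment a b) <-> a != b.
Proof.
split=> [[x [y [xy Fx Fy _]]]|ab].
  apply: contraNneq xy => ab; move: Fx Fy; rewrite ab.
  by move=> [t _ <-] [u _ <-]; rewrite -!scalerDl !subrKC.
exists b, a; split; [by rewrite eq_sym|exact: segmentr|exact: segmentl|].
move=> _ [t _ <-]; exists t; rewrite scalerBl scale1r scalerBr.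
by rewrite addrCA addrA.
Qed.

Definition weight_form P : 'rV[R]_2 := \row_i (if i == ord0 then P.1 else P.2)%:R.

Lemma weight_formE P m :
  \sum_i weight_form P 0 i * expo R m 0 i = (radial_deg P m)%:R.
Proof. by rewrite sum_ord2 expo0 expo1 !mxE /= -!natrM -natrD. Qed.

Lemma weight_form_positive P : positive_weight P -> positive_form (weight_form P).
Proof. by case=> P0 P1; split; rewrite mxE ltr0n. Qed.

Definition face_of P f := minimizers (newton_polygon f) (weight_form P).

Lemma face_ofP P f m : positive_weight P -> m \in msupp f ->
  face_of P f (expo R m) <-> minimal_mono P f m.
Proof.
move=> Ppos mf; split=> [[_ mmin]|[_ mmin]].
  split=> // k kf; have := mmin _ (expo_polygon kf).
  by rewrite !weight_formE ler_nat.
split; first exact: expo_polygon.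
move=> y Ky; rewrite weight_formE.
apply: (polygon_ge (weight_form_positive Ppos)) Ky => k kf.
by rewrite weight_formE ler_nat; apply: mmin.
Qed.

Lemma part_on_face_of P f : positive_weight P -> part_on f (face_of P f) = face_fun P f.
Proof.
move=> Ppos; apply/mpolyP => m; rewrite mcoeff_part mcoeff_face.
have [mf|] := boolP (m \in msupp f); last first.
  by rewrite mcoeff_msupp negbK => /eqP->; rewrite !if_same.
have -> // : (expo R m \in face_of P f) = (radial_deg P m == min_radial_deg P f).
apply/idP/eqP => [|mdeg].
  by rewrite inE => /(face_ofP Ppos mf) /minimal_monoP[].
by rewrite inE; apply/(face_ofP Ppos mf)/minimal_monoP.
Qed.

Lemma compact_face_of P f : f != 0 -> positive_weight P -> compact_face f (face_of P f).
Proof.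
move=> f0 Ppos; have wpos := weight_form_positive Ppos.
have [a [b [af bf E]]] := minimizers_is_segment f0 wpos.
split; last by rewrite /face_of E; apply: compact_rVsegment.
split; last by exists (weight_form P).
by rewrite /face_of E; exists (expo R a); apply: segmentl.
Qed.

(** Two minimal monomials for a positive weight lie on a common non-vertical
    line, so they give different points of the plane iff their abscissas
    differ. *)
Definition edge_weight f P : Prop :=
  positive_weight P /\ exists a b,
    [/\ minimal_mono P f a, minimal_mono P f b & abscissa a != abscissa b].

Lemma edge_one_face f P : f != 0 -> edge_weight f P -> one_face f (face_of P f).
Proof.
move=> f0 [Ppos [a [b [amin bmin ab]]]]; split; first exact: compact_face_of.
have [c [d [cf df E]]] := minimizers_is_segment f0 (weight_form_positive Ppos).
rewrite /face_of E; apply/dim1_segment; apply: contra_neq ab => cd.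
move: E; rewrite cd segmentxx => E.
have mono m : minimal_mono P f m -> expo R m = expo R d.
  move=> mmin; have : face_of P f (expo R m) by apply/(face_ofP Ppos) => //; case: mmin.
  by rewrite /face_of E.
apply/eqP; rewrite -(eqr_nat R) -!expo0.
by rewrite (mono a) // (mono b).
Qed.

(** This reduces 1-faces to a condition on the finite support.  Only the equality
    of the parts of [f] links the weight to the face F; but the two end points
    of F are monomials of [f], and equality of the parts makes both of them
    minimal for the weight. *)
Lemma one_face_weightP f P : f != 0 -> one_face_weight f P <-> edge_weight f P.
Proof.
move=> f0; split=> [[Ppos [F [[[Fne [w Fw]] Fc] Fdim] PF]]|Pedge].
  split=> //; have {Fw} Fw : F = minimizers (newton_polygon f) w := Fw.
  have wpos : positive_form w.
    by apply: (@compact_face_positive _ f); rewrite -Fw.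
  have [a [b [af bf E]]] := minimizers_is_segment f0 wpos.
  move: Fdim; rewrite Fw E => /dim1_segment ab.
  have inface m : m \in msupp f -> F (expo R m) -> minimal_mono P f m.
    move=> mf Fm; apply/msupp_face_fun; rewrite PF mcoeff_msupp mcoeff_part.
    by rewrite mem_set // -mcoeff_msupp.
  have Fa : F (expo R a) by rewrite Fw E; apply: segmentl.
  have Fb : F (expo R b) by rewrite Fw E; apply: segmentr.
  exists a, b; split; [exact: inface|exact: inface|].
  apply: contra_neq ab => xab.
  move: Fa Fb; rewrite Fw => -[Ka mina] [Kb minb].
  have : \sum_i w 0 i * expo R a 0 i = \sum_i w 0 i * expo R b 0 i.
    by apply/le_anti; rewrite mina ?minb.
  rewrite !sum_ord2 !expo0 !expo1 xab => /addrI /mulfI wn0.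
  apply: rV2P; rewrite ?expo0 ?expo1 ?xab // wn0 // gt_eqF //.
  by case: wpos.
have Ppos := Pedge.1; split=> //; exists (face_of P f); first exact: edge_one_face.
by rewrite part_on_face_of.
Qed.

Lemma face_of_vertex f P a : f != 0 -> positive_weight P -> minimal_mono P f a ->
  ~ edge_weight f P -> face_of P f = [set expo R a].
Proof.
move=> f0 Ppos amin nedge.
have [c [d [cf df E]]] := minimizers_is_segment f0 (weight_form_positive Ppos).
have mono m : m \in msupp f -> face_of P f (expo R m) -> expo R m = expo R a.
  move=> mf /(face_ofP Ppos mf) mmin.
  have xma : abscissa m = abscissa a.
    by apply/eqP; apply: contraT => ma; case: nedge; split=> //; exists m, a.
  apply: rV2P; rewrite ?expo0 ?expo1 ?xma //; congr _%:R.
  move: mmin amin => [_ mmin] [ain amin]; have := mmin a ain; have := amin m mf.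
  by rewrite xma !leq_add2l !leq_pmul2l ?Ppos.2 // => *; apply/anti_leq/andP.
have {}E : face_of P f = segment (expo R c) (expo R d) := E.
have Fc : face_of P f (expo R c) by rewrite E; apply: segmentl.
have Fd : face_of P f (expo R d) by rewrite E; apply: segmentr.
by rewrite E (mono c cf Fc) (mono d df Fd) segmentxx.
Qed.

(** A monomial below and to the left of all others minimizes every positive
    form, and it is the only point of a compact face because such a face comes
    from a positive form. *)
Lemma single_vertex_corner f a : f != 0 -> a \in msupp f ->
    (forall m, m \in msupp f -> (abscissa a <= abscissa m)%N) ->
    (forall m, m \in msupp f -> (ordinate a <= ordinate m)%N) ->
  single_vertex f.
Proof.
move=> f0 af xa ya; exists (expo R a).
have corner P : minimal_mono P f a.
  by split=> // m mf; rewrite leq_add // leq_mul ?xa ?ya.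
apply/seteqP; split=> [z [F [[Fne [w Fw]] Fc] Fz]|_ ->]; last first.
  have Ppos : positive_weight (1, 1)%N by [].
  exists (face_of (1, 1)%N f); first exact: compact_face_of.
  exact/face_ofP.
have {Fw} Fw : F = minimizers (newton_polygon f) w := Fw.
have wpos : positive_form w.
  by apply: (@compact_face_positive _ f); rewrite -Fw.
move: Fz; rewrite Fw => -[Kz minz].
have [c [d [cf df E]]] := minimizers_is_segment f0 wpos.
have [w0 w1] := wpos.
have corner_eq m : m \in msupp f ->
    minimizers (newton_polygon f) w (expo R m) -> expo R m = expo R a.
  move=> mf [_ /(_ _ (expo_polygon af))]; rewrite !sum_ord2 !expo0 !expo1.
  have := xa _ mf; have := ya _ mf; rewrite -!(ler_nat R) => ym xm le.
  by apply: rV2P; rewrite ?expo0 ?expo1; nra.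
have Fc0 : minimizers (newton_polygon f) w (expo R c) by rewrite E; apply: segmentl.
have Fd0 : minimizers (newton_polygon f) w (expo R d) by rewrite E; apply: segmentr.
have Fz : minimizers (newton_polygon f) w z by split.
by move: Fz; rewrite E (corner_eq c cf Fc0) (corner_eq d df Fd0) segmentxx.
Qed.

End Faces.

(** * Position of a weight relative to the 1-faces *)

Section Tilt.
Local Open Scope nat_scope.

Lemma tilt_left_point p q p' q' x y x' y' : 0 < q -> p' * q < p * q' -> x' < x ->
  p * x + q * y <= p * x' + q * y' -> p' * x + q' * y < p' * x' + q' * y'.
Proof.
move=> q0 lt xx le; rewrite -(ltn_pmul2l q0).
have : q' * (p * x + q * y) <= q' * (p * x' + q * y') by rewrite leq_mul2l le orbT.
have : (p' * q) * (x - x') < (p * q') * (x - x') by rewrite ltn_pmul2r ?subn_gt0.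
nia.
Qed.

Lemma tilt_right_point p q p' q' x y x' y' : 0 < q -> 0 < q' -> p * q' <= p' * q -> x <= x' ->
  p * x + q * y < p * x' + q * y' -> p' * x + q' * y < p' * x' + q' * y'.
Proof.
move=> q0 q0' le xx lt; rewrite -(ltn_pmul2l q0).
have : q' * (p * x + q * y) < q' * (p * x' + q * y') by rewrite ltn_pmul2l.
have : (p * q') * (x' - x) <= (p' * q) * (x' - x) by rewrite leq_mul2r le orbT.
nia.
Qed.

End Tilt.

Section Core.
Variable R : realType.
Implicit Types (f h : mixed R) (P Q : nat * nat) (u v : R[i]) (m : 'X_{1..4}).

Definition slope_below Q P : Prop := (Q.1 * P.2 < P.1 * Q.2)%N.

(** The slope of an edge weight is determined by two points of the support.
    Finiteness is what makes first and last weights exist. *)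
Lemma edge_slopes f : exists L : seq rat, forall P, edge_weight f P -> slope P \in L.
Proof.
exists [seq ((ordinate b)%:R - (ordinate a)%:R) / ((abscissa a)%:R - (abscissa b)%:R)
       | a <- msupp f, b <- msupp f].
move=> P [[P1 P2] [a [b [[af amin] [bf bmin] ab]]]].
suff -> : slope P =
    ((ordinate b)%:R - (ordinate a)%:R) / ((abscissa a)%:R - (abscissa b)%:R).
  exact: allpairs_f.
have ab0 : (abscissa a)%:R - (abscissa b)%:R != 0 :> rat by rewrite subr_eq0 eqr_nat.
have P20 : P.2%:R != 0 :> rat by rewrite pnatr_eq0 -lt0n.
apply/eqP; rewrite /slope eqr_div //; apply/eqP.
have : (P.1 * abscissa a + P.2 * ordinate a = P.1 * abscissa b + P.2 * ordinate b)%N.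
  by apply/anti_leq; rewrite amin ?bmin.
by move/(congr1 (fun n => n%:R : rat)) => /= E; rewrite !natrD !natrM in E; lra.
Qed.

Lemma extreme_weights f P : f != 0 -> edge_weight f P ->
  (exists Q, first_weight f Q) /\ (exists Q, last_weight f Q).
Proof.
move=> f0 Pedge; have [L Lslope] := edge_slopes f.
pose G := [seq t <- L | `[< exists2 Q, edge_weight f Q & slope Q = t >]].
have inG Q : edge_weight f Q -> slope Q \in G.
  by move=> Qedge; rewrite mem_filter Lslope // andbT; apply/asboolP; exists Q.
split.
  have [t] := @exists_seq_min _ _ rat^d (id : rat -> rat^d) _ _ (inG P Pedge).
  rewrite mem_filter => /andP[/asboolP[Q Qedge <-] _] tmin.
  exists Q; split=> [|Q' Q'edge]; first exact/one_face_weightP.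
  by apply: tmin; apply: inG; apply/one_face_weightP.
have [t] := exists_seq_min (id : rat -> rat) (inG P Pedge).
rewrite mem_filter => /andP[/asboolP[Q Qedge <-] _] tmin.
exists Q; split=> [|Q' Q'edge]; first exact/one_face_weightP.
by apply: tmin; apply: inG; apply/one_face_weightP.
Qed.

Lemma tie_left f P a b : positive_weight P -> minimal_mono P f a ->
    ~ edge_weight f P -> b \in msupp f -> (abscissa b < abscissa a)%N ->
  exists Q, [/\ edge_weight f Q, minimal_mono Q f a &
    exists2 c, minimal_mono Q f c & (abscissa c < abscissa a)%N].
Proof.
move=> [P1 P2] amin nedge bf ba.
have auniq c : minimal_mono P f c -> abscissa c = abscissa a.
  move=> cmin; apply/eqP; apply: contraT => ca; case: nedge; split=> //.
  by exists c, a.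
have [p [q [p0 q0 lt amin' [c cmin ca]]]] := tilted_tie P1 P2 amin auniq bf ba.
exists (p, q); split=> //; last by exists c.
by split=> //; exists c, a; rewrite neq_ltn ca.
Qed.

Lemma weighted_minC (T : eqType) (s : seq T) (x y : T -> nat) p q a :
  weighted_min s x y p q a <-> weighted_min s y x q p a.
Proof.
by split=> -[ain amin]; split=> // b bin; rewrite addnC [leqRHS]addnC; apply: amin.
Qed.

Lemma tie_down f P a b : positive_weight P -> minimal_mono P f a ->
    ~ edge_weight f P -> b \in msupp f -> (ordinate b < ordinate a)%N ->
  exists Q, [/\ edge_weight f Q, slope_below Q P & minimal_mono Q f a].
Proof.
move=> [P1 P2] /weighted_minC amin nedge bf ba.
have auniq c : weighted_min (msupp f) ordinate abscissa P.2 P.1 c ->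
    ordinate c = ordinate a.
  move=> cmin.
  have xca : abscissa c = abscissa a.
    apply/eqP; apply: contraT => ca; case: nedge; split=> //.
    by exists c, a; split=> //; apply/weighted_minC.
  move: cmin amin => [cf cmin] [af amin].
  have := cmin a af; have := amin c cf; rewrite xca !leq_add2r !leq_pmul2l //.
  by move=> *; apply/anti_leq/andP.
have [q [p [q0 p0 lt amin' [c cmin ca]]]] := tilted_tie P2 P1 amin auniq bf ba.
exists (p, q); split; last exact/weighted_minC.
  split=> //; exists c, a; split; [exact/weighted_minC|exact/weighted_minC|].
  apply: contraL ca => /eqP xca; rewrite -leqNgt.
  move: cmin amin' => [cf cmin] [af amin'].
  by have := amin' c cf; rewrite xca leq_add2r leq_pmul2l.
by rewrite /slope_below /=; move: lt; rewrite mulnC [X in (_ < X)%N]mulnC.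
Qed.

(** The common shape of IND and SIND, which differ only in whether a degenerate
    point has to be a zero of the face function: [bad g u v] stands for
    degeneracy of [g] at (u, v). *)
Definition inner_nondegenerate (bad : mixed R -> R[i] -> R[i] -> Prop) f : Prop :=
  (single_vertex f ->
     forall u v, (u, v) != (0, 0) -> ~ bad (gamma_part f) u v) /\
  (~ single_vertex f ->
   [/\ forall P, first_weight f P -> forall u v, v != 0 -> ~ bad (face_fun P f) u v,
       forall P, last_weight f P -> forall u v, u != 0 -> ~ bad (face_fun P f) u v,
       forall F, one_face f F -> forall u v, u != 0 -> v != 0 ->
         ~ bad (part_on f F) u v &
       forall x, nonextreme_vertex f x -> forall u v, u != 0 -> v != 0 ->
         ~ bad (part_on f [set x]) u v]).

Lemma face_fun_single_vertex f P : f != 0 -> positive_weight P ->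
  single_vertex f -> face_fun P f = gamma_part f.
Proof.
move=> f0 Ppos [x bx]; rewrite -part_on_face_of // /gamma_part bx; congr part_on.
have sub : face_of P f `<=` [set x].
  by rewrite -bx => z Fz; exists (face_of P f) => //; apply: compact_face_of.
have [[[z Fz] _] _] := compact_face_of f0 Ppos.
by apply/seteqP; split=> // _ ->; rewrite -(sub z Fz).
Qed.

Lemma minimal_mono_exists f P : f != 0 -> exists a, minimal_mono P f a.
Proof.
by move=> f0; have [m mf mdeg] := min_radial_deg_attained P f0; exists m; apply/minimal_monoP.
Qed.

Lemma extreme_weights_exist f : f != 0 -> ~ single_vertex f ->
  (exists Q, first_weight f Q) /\ (exists Q, last_weight f Q).
Proof.
move=> f0 nsv; have [a amin] := minimal_mono_exists (1, 1)%N f0.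
suff [Q Qedge] : exists Q, edge_weight f Q by exact: extreme_weights Qedge.
have Ppos : positive_weight (1, 1)%N by [].
apply: contrapT => /forallNP nedge; have nedge1 := nedge (1, 1)%N.
apply: nsv; apply: (@single_vertex_corner _ f a) => // [|m mf|m mf]; first by case: amin.
  rewrite leqNgt; apply/negP => /(tie_left Ppos amin nedge1 mf) [Q [Qedge _ _]].
  exact: nedge Qedge.
rewrite leqNgt; apply/negP => /(tie_down Ppos amin nedge1 mf) [Q [Qedge _ _]].
exact: nedge Qedge.
Qed.

Lemma unique_minimal_strict f P a b : minimal_mono P f a -> ~ edge_weight f P ->
    positive_weight P -> b \in msupp f -> abscissa b != abscissa a ->
  (P.1 * abscissa a + P.2 * ordinate a < P.1 * abscissa b + P.2 * ordinate b)%N.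
Proof.
move=> amin nedge Ppos bf ba; rewrite ltnNge; apply/negP => le; apply: nedge.
split=> //; exists b, a; split=> //; split=> // c cf.
exact: leq_trans (amin.2 c cf).
Qed.

Lemma edge_second_mono f Q a : edge_weight f Q ->
  exists2 b, minimal_mono Q f b & abscissa b != abscissa a.
Proof.
case=> _ [b [c [bmin cmin bc]]].
have [ba|ba] := eqVneq (abscissa b) (abscissa a); last by exists b.
by exists c; rewrite // -ba eq_sym.
Qed.

(** If the vertex selected by P is the leftmost point of the support, every
    weight at least as steep as P selects that point alone, hence is not an edge
    weight: P lies beyond all of them. *)
Lemma left_extreme_slopes f P Q a : positive_weight P -> minimal_mono P f a ->
    ~ edge_weight f P -> (forall b, b \in msupp f -> (abscissa a <= abscissa b)%N) ->
  edge_weight f Q -> slope_below Q P.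
Proof.
move=> Ppos amin nedge left Qedge; have [[_ P2] [[_ Q2] _]] := (Ppos, Qedge).
have [b [bf bmin] ba] := edge_second_mono a Qedge.
rewrite /slope_below ltnNge; apply/negP => le.
have := unique_minimal_strict amin nedge Ppos bf ba.
move=> /(tilt_right_point P2 Q2 le (left b bf)); apply/negP; rewrite -leqNgt.
exact: bmin amin.1.
Qed.

Lemma right_extreme_slopes f P Q a : positive_weight P -> minimal_mono P f a ->
    ~ edge_weight f P -> (forall b, b \in msupp f -> (ordinate a <= ordinate b)%N) ->
  edge_weight f Q -> slope_below P Q.
Proof.
move=> Ppos amin nedge low Qedge; have [[P1 _] [[Q1 _] _]] := (Ppos, Qedge).
have [b [bf bmin] ba] := edge_second_mono a Qedge.
rewrite /slope_below ltnNge mulnC [X in (_ <= X)%N]mulnC; apply/negP => le.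
have := unique_minimal_strict amin nedge Ppos bf ba.
rewrite addnC [X in (_ < X)%N]addnC.
move=> /(tilt_right_point P1 Q1 le (low b bf)); apply/negP; rewrite -leqNgt.
rewrite addnC [X in (_ <= X)%N]addnC; exact: bmin amin.1.
Qed.

(** The geometric half of the theorem.  The face function of P is that of a
    1-face, of a non-extreme vertex, or of an extreme vertex.  The first two
    cases are covered by the hypothesis; in the last one P lies beyond the first
    or the last weight, whose face function is known to be nondegenerate on a
    whole punctured axis.  For a single vertex all face functions coincide. *)
Lemma nondegenerate_faces bad f : f != 0 -> inner_nondegenerate bad f ->
  forall P, positive_weight P -> forall u v, u != 0 -> v != 0 ->
  [/\ exists2 Q, positive_weight Q & ~ bad (face_fun Q f) 0 v,
      exists2 Q, positive_weight Q & ~ bad (face_fun Q f) u 0 &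
      [\/ ~ bad (face_fun P f) u v,
          exists Q, [/\ positive_weight Q, slope_below Q P & ~ bad (face_fun Q f) 0 v] |
          exists Q, [/\ positive_weight Q, slope_below P Q & ~ bad (face_fun Q f) u 0]]].
Proof.
move=> f0 [sv nsv] P Ppos u v u0 v0.
have [fsv|fnsv] := pselect (single_vertex f).
  have {}sv := sv fsv.
  have bad_face Q u' v' : positive_weight Q -> (u', v') != (0, 0) ->
      ~ bad (face_fun Q f) u' v'.
    by move=> Qpos; rewrite face_fun_single_vertex //; apply: sv.
  have pos1 : positive_weight (1, 1)%N by [].
  split; last by constructor 1; apply: bad_face => //; rewrite xpair_eqE (negPf u0).
    by exists (1, 1)%N => //; apply: bad_face => //; rewrite xpair_eqE (negPf v0) andbF.
  by exists (1, 1)%N => //; apply: bad_face => //; rewrite xpair_eqE (negPf u0).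
have [first_bad last_bad edge_bad vertex_bad] := nsv fnsv.
have [[Q1 Q1first] [QN QNlast]] := extreme_weights_exist f0 fnsv.
have [Q1pos QNpos] := (Q1first.1.1, QNlast.1.1).
split; [by exists Q1 => //; apply: first_bad|by exists QN => //; apply: last_bad|].
have [Pedge|nedge] := pselect (edge_weight f P).
  by constructor 1; rewrite -part_on_face_of //; apply: edge_bad => //; apply: edge_one_face.
have [a amin] := minimal_mono_exists P f0; have af := amin.1.
have [[b bf ba]|noleft] :=
    pselect (exists2 b, b \in msupp f & (abscissa b < abscissa a)%N); last first.
  constructor 2; exists Q1; split=> //; last exact: first_bad.
  apply: (left_extreme_slopes Ppos amin nedge) => [b bf|].
    by rewrite leqNgt; apply/negP => ba; apply: noleft; exists b.
  by apply/one_face_weightP => //; case: Q1first.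
have [[c cf ca]|nobelow] :=
    pselect (exists2 c, c \in msupp f & (ordinate c < ordinate a)%N); last first.
  constructor 3; exists QN; split=> //; last exact: last_bad.
  apply: (right_extreme_slopes Ppos amin nedge) => [c cf|].
    by rewrite leqNgt; apply/negP => ca; apply: nobelow; exists c.
  by apply/one_face_weightP => //; case: QNlast.
(* There are points of the support on both sides of the vertex, and tilting P
   in either direction produces a 1-face through it.  The two 1-faces differ:
   the one obtained by increasing the slope contains a point left of the
   vertex, whose value rises above that of the vertex when the slope falls. *)
constructor 1; rewrite -part_on_face_of // (face_of_vertex f0 Ppos amin nedge).
apply: vertex_bad => //; split.
  by rewrite /vertex -(face_of_vertex f0 Ppos amin nedge); apply: compact_face_of.
have [Q [Qedge aQ [d dQ da]]] := tie_left Ppos amin nedge bf ba.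
have [Q' [Q'edge Q'P aQ']] := tie_down Ppos amin nedge cf ca.
exists (face_of Q f), (face_of Q' f); split.
- exact: edge_one_face.
- exact: edge_one_face.
- move=> FF; have : face_of Q f (expo R d).
    by apply/face_ofP; [exact: Qedge.1|exact: dQ.1|].
  rewrite FF => /face_ofP dQ'; have := dQ' Q'edge.1 dQ.1 => -[df dmin].
  have := tilt_left_point Ppos.2 Q'P da (amin.2 d df); apply/negP; rewrite -leqNgt.
  exact: dmin af.
- by apply/face_ofP; first exact: Qedge.1.
by apply/face_ofP; first exact: Q'edge.1.
Qed.

End Core.

(** * Initial forms of the singular polynomials *)

Section InitialForms.
Variable R : realType.
Implicit Types (f g h : mixed R) (P Q : nat * nat) (u v : R[i]) (m : 'X_{1..4}).

Lemma radial_degD P (m n : 'X_{1..4}) :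
  radial_deg P (m + n)%MM = (radial_deg P m + radial_deg P n)%N.
Proof. by rewrite /radial_deg !mnmDE; lia. Qed.

Lemma msupp_mul f g m : m \in msupp (f * g) ->
  exists a b, [/\ a \in msupp f, b \in msupp g & m = (a + b)%MM].
Proof. by move=> /msuppM_le /allpairsP[[a b] [/= af bg ->]]; exists a, b. Qed.

Lemma msupp_deriv i f m : m \in msupp f^`M(i) -> (m + U_(i))%MM \in msupp f.
Proof.
rewrite !mcoeff_msupp mcoeff_deriv; apply: contra_neq => ->; exact: mul0rn.
Qed.

Definition conj_var (i : 'I_4) : 'I_4 := tnth [tuple iub; ivb; iu; iv] i.
Definition conj_mono m : 'X_{1..4} := [multinom m (conj_var i) | i < 4].

Lemma conj_varK : involutive conj_var.
Proof. by case=> [[|[|[|[|]]]]] // lt; apply: val_inj. Qed.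

Lemma mixed_conjE f :
  mixed_conj f = \sum_(m <- msupp f) (f@_m)^* *: 'X_[conj_mono m].
Proof.
rewrite /mixed_conj {1}(mpolyE f) [X in X \mPo _]raddf_sum raddf_sum /=.
apply: eq_bigr => m _.
rewrite map_mpolyZ map_mpolyX comp_mpolyZ comp_mpolyX; congr (_ *: _).
rewrite [RHS]mpolyXE_id [RHS](reindex_inj (inv_inj conj_varK)) /=.
apply: eq_bigr => i _; rewrite mnmE conj_varK; congr (_ ^+ _).
by case: i => [[|[|[|[|]]]]].
Qed.

Lemma radial_deg_conj P m : radial_deg P (conj_mono m) = radial_deg P m.
Proof.
rewrite /radial_deg !mnmE; congr (_ * _ + _ * _)%N; exact: addnC.
Qed.

Lemma msupp_conj f m : m \in msupp (mixed_conj f) ->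
  exists2 k, k \in msupp f & m = conj_mono k.
Proof.
rewrite mixed_conjE => /msupp_sum_le /flattenP[s /mapP[k]].
rewrite mem_filter /= => kf -> /msuppZ_le; rewrite msuppX mem_seq1 => /eqP ->.
by exists k.
Qed.

Lemma mixed_conjB f g : mixed_conj (f - g) = mixed_conj f - mixed_conj g.
Proof. by rewrite /mixed_conj raddfB /= comp_mpolyB. Qed.

Variable P : nat * nat.

(** The terms of least degree of [h], up to a fixed shift: derivatives lower
    degrees, and [s] makes up for it so that natural subtraction is avoided.
    [g] may vanish, when the terms of degree [d] cancel. *)
Definition initial (s d : nat) (h g : mixed R) : Prop :=
  (forall m, m \in msupp g -> (radial_deg P m + s = d)%N) /\
  (forall m, m \in msupp (h - g) -> (d < radial_deg P m + s)%N).

Lemma initial_face f : initial 0 (min_radial_deg P f) f (face_fun P f).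
Proof.
split=> m; rewrite mcoeff_msupp addn0.
  by rewrite mcoeff_face; case: (radial_deg P m =P _) => //; rewrite eqxx.
rewrite mcoeffB mcoeff_face; case: (radial_deg P m =P _) => [|ne].
  by rewrite subrr eqxx.
rewrite subr0 -mcoeff_msupp => mf.
by rewrite ltn_neqAle min_radial_deg_le // andbT eq_sym; apply/eqP.
Qed.

Lemma initialM s d h g s' d' h' g' : initial s d h g -> initial s' d' h' g' ->
  initial (s + s') (d + d') (h * h') (g * g').
Proof.
move=> [gd hd] [gd' hd']; split=> m.
  by move=> /msupp_mul [a [b [/gd <- /gd' <- ->]]]; rewrite radial_degD; lia.
have -> : h * h' - g * g' = g * (h' - g') + (h - g) * g' + (h - g) * (h' - g').
  by ring.
move=> /msuppD_le; rewrite mem_cat => /orP[/msuppD_le|];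
  [rewrite mem_cat => /orP[]|];
  move=> /msupp_mul [a [b [ag bg ->]]]; rewrite radial_degD.
- by have := gd _ ag; have := hd' _ bg; lia.
- by have := hd _ ag; have := gd' _ bg; lia.
- by have := hd _ ag; have := hd' _ bg; lia.
Qed.

Lemma initialB s d h g h' g' : initial s d h g -> initial s d h' g' ->
  initial s d (h - h') (g - g').
Proof.
move=> [gd hd] [gd' hd']; split=> m.
  by move=> /msuppB_le; rewrite mem_cat => /orP[/gd|/gd'].
have -> : h - h' - (g - g') = (h - g) - (h' - g') by ring.
by move=> /msuppB_le; rewrite mem_cat => /orP[/hd|/hd'].
Qed.

Lemma initial_deriv i s d h g : initial s d h g ->
  initial (s + radial_deg P U_(i)) d h^`M(i) g^`M(i).
Proof.
move=> [gd hd]; split=> m.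
  by move=> /msupp_deriv /gd; rewrite radial_degD; lia.
by rewrite -mderivB => /msupp_deriv /hd; rewrite radial_degD; lia.
Qed.

Lemma initial_conj s d h g : initial s d h g ->
  initial s d (mixed_conj h) (mixed_conj g).
Proof.
move=> [gd hd]; split=> m.
  by move=> /msupp_conj [k /gd <- ->]; rewrite radial_deg_conj.
by rewrite -mixed_conjB => /msupp_conj [k /hd + ->]; rewrite radial_deg_conj.
Qed.

(** Either [g] vanishes, or it consists of the terms of [h] of least degree and
    is the face function.  Cancellation can thus only add zeros. *)
Lemma initial_zero s d h g u v : initial s d h g ->
  mixed_eval (face_fun P h) u v = 0 -> mixed_eval g u v = 0.
Proof.
move=> [gd hd]; have [->|g0] := eqVneq g 0.
  by rewrite /mixed_eval meval0.
suff -> : face_fun P h = g by [].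
have hE m : (radial_deg P m + s = d)%N -> h@_m = g@_m.
  move=> md; apply/eqP; rewrite -subr_eq0 -mcoeffB; apply: contraTT isT.
  by rewrite -mcoeff_msupp => /hd; rewrite md ltnn.
have gE m : (radial_deg P m + s != d)%N -> g@_m = 0.
  by move=> md; apply/eqP; apply: contraNT md; rewrite -mcoeff_msupp => /gd ->.
have hge m : m \in msupp h -> (d <= radial_deg P m + s)%N.
  move=> mh; have [//|lt] := leqP d (radial_deg P m + s)%N.
  have g0m : g@_m = 0 by apply: gE; rewrite ltn_eqF.
  have /hd : m \in msupp (h - g).
    by rewrite mcoeff_msupp mcoeffB g0m subr0 -mcoeff_msupp.
  by rewrite ltnNge ltnW.
have lead : (radial_deg P (mlead g) + s = d)%N by apply: gd; apply: mlead_supp.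
have leadh : mlead g \in msupp h by rewrite mcoeff_msupp hE // -mcoeff_msupp mlead_supp.
have /minimal_monoP [_ mindeg] : minimal_mono P h (mlead g).
  split=> // n /hge; rewrite -lead leq_add2r; exact.
apply/mpolyP => m; rewrite mcoeff_face -mindeg -(eqn_add2r s) lead.
by case: eqP => [/hE //|/eqP /gE ->].
Qed.

(** The singular polynomials are built from derivatives and conjugates by
    homogeneous operations, so those of the face function are initial forms of
    those of [f]. *)
Lemma critical_face f u v :
    mixed_eval (face_fun P (s1 f)) u v = 0 ->
    mixed_eval (face_fun P (s2 f)) u v = 0 ->
    mixed_eval (face_fun P (s3 f)) u v = 0 ->
  critical (face_fun P f) u v.
Proof.
have fin := initial_face f.
have der i := initial_deriv i fin.
have derc i := initial_conj (der i).
(* A variable and its conjugate have the same weight, so the two products of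
   each difference carry the same shift. *)
have rdeg_bar i : radial_deg P U_(conj_var i) = radial_deg P U_(i).
  by case: i => [[|[|[|[|]]]]] // lt; rewrite /radial_deg !mnm1E.
have Eu : radial_deg P U_(iub) = radial_deg P U_(iu) := rdeg_bar iu.
have Ev : radial_deg P U_(ivb) = radial_deg P U_(iv) := rdeg_bar iv.
split.
- apply: initial_zero H; apply: initialB; first exact: initialM (der iu) (derc ivb).
  rewrite Ev -Eu; exact: initialM (derc iub) (der iv).
- apply: initial_zero H0; apply: initialB; first exact: initialM (der iu) (derc iu).
  rewrite -Eu; exact: initialM (der iub) (derc iub).
apply: initial_zero H1; apply: initialB; first exact: initialM (der iv) (derc iv).
rewrite -Ev; exact: initialM (der ivb) (derc ivb).
Qed.

End InitialForms.

(** * Restriction of face functions to the axes *)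

Section Axes.
Variable R : realType.
Implicit Types (f g h : mixed R) (P Q : nat * nat) (u v : R[i]) (m : 'X_{1..4}).

Definition axis_part (x : 'X_{1..4} -> nat) g : mixed R :=
  \sum_(m <- msupp g | x m == 0%N) g@_m *: 'X_[m].

Lemma mcoeff_axis x g m : (axis_part x g)@_m = if x m == 0%N then g@_m else 0.
Proof. exact: mcoeff_filter. Qed.

(** Suppose that the face function of [h] for Q has terms on the axis [x] = 0,
    and let [k] agree with [h] on that axis.  These terms have the least [y]
    there.  Any off-axis term of [k] lies above the line through them of weight
    Q, hence strictly above the one for P, which gives more weight to [x]; so
    they make up the whole face function of [k] for P.  Both [k] = [h] with a
    smaller slope for Q, and [k] the restriction of [h] to the axis with
    arbitrary weights, are of this form. *)
Lemma axis_part_face (x y : 'X_{1..4} -> nat) p q p' q' P Q h (k : mixed R) :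
    (forall m, radial_deg P m = p * x m + q * y m)%N ->
    (forall m, radial_deg Q m = p' * x m + q' * y m)%N ->
    (0 < q)%N -> (0 < q')%N ->
    (forall m, x m = 0%N -> k@_m = h@_m) ->
    (forall m, m \in msupp k -> x m <> 0%N -> m \in msupp h /\ p' * q < p * q')%N ->
  axis_part x (face_fun Q h) = 0 \/ face_fun P k = axis_part x (face_fun Q h).
Proof.
move=> HP HQ q0 q0' kh off; set g := axis_part x _.
have [->|g0] := eqVneq g 0; [by left|right].
have := mlead_supp g0; set a := mlead g.
rewrite mcoeff_msupp mcoeff_axis; case: (x a =P 0%N) => [xa|]; last by rewrite eqxx.
rewrite -mcoeff_msupp => /msupp_face_fun amin.
have /minimal_monoP [ah adeg] := amin.
have above m : m \in msupp k -> (q * y a <= radial_deg P m)%N /\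
    (radial_deg P m = q * y a -> x m = 0)%N.
  move=> mk; have [xm|xm] := eqVneq (x m) 0%N.
    split=> //; rewrite HP xm muln0 add0n leq_pmul2l // -(leq_pmul2l q0').
    have mh : m \in msupp h by rewrite mcoeff_msupp -kh // -mcoeff_msupp.
    by have := min_radial_deg_le Q mh; rewrite -adeg !HQ xa xm !muln0.
  have [mh lt] := off m mk (elimN eqP xm).
  suff : (q * y a < radial_deg P m)%N by move=> lt'; split=> [|e]; [exact: ltnW|rewrite e ltnn in lt'].
  have := min_radial_deg_le Q mh; rewrite -adeg !HQ HP xa muln0 add0n.
  rewrite -(ltn_pmul2l q0') -lt0n in xm * => le.
  have : (p' * q * x m < p * q' * x m)%N by rewrite ltn_pmul2r.
  have : (q * (q' * y a) <= q * (p' * x m + q' * y m))%N by rewrite leq_mul2l le orbT.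
  by clear; lia.
have ak : a \in msupp k by rewrite mcoeff_msupp kh // -mcoeff_msupp.
have /minimal_monoP [_ mink] : minimal_mono P k a.
  split=> // m /above[le _]; rewrite -/(radial_deg P m) -/(radial_deg P a).
  by rewrite (HP a) xa muln0.
apply/mpolyP => m; rewrite mcoeff_face -mink mcoeff_axis mcoeff_face -adeg.
have [xm|xm] := eqVneq (x m) 0%N.
  rewrite kh // !HP !HQ xm xa !muln0 !add0n !eqn_pmul2l //.
case: eqP => // mdeg; apply/eqP; apply: contraNT xm; rewrite -mcoeff_msupp => mk.
by apply/eqP; apply: (above m mk).2; rewrite mdeg HP xa muln0.
Qed.

Lemma mixed_evalE f u v :
  mixed_eval f u v = \sum_(m <- msupp f) f@_m * mixed_eval 'X_[m] u v.
Proof.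
rewrite /mixed_eval {1}(mpolyE f) raddf_sum /=.
by apply: eq_bigr => m _; rewrite mevalZ.
Qed.

Lemma mixed_evalX u v m : mixed_eval 'X_[m] u v =
  u ^+ m iu * v ^+ m iv * u^* ^+ m iub * v^* ^+ m ivb.
Proof.
rewrite /mixed_eval mevalX !big_ord_recl big_ord0 mulr1 !mulrA.
by do !congr (_ * _); congr (_ ^+ m _); apply: val_inj.
Qed.

Lemma mixed_eval_axis x f u v u' v' :
    (forall m, x m = 0%N -> mixed_eval 'X_[m] u v = mixed_eval 'X_[m] u' v' :> R[i]) ->
    (forall m, x m <> 0%N -> mixed_eval 'X_[m] u' v' = 0 :> R[i]) ->
  mixed_eval (axis_part x f) u v = mixed_eval f u' v'.
Proof.
move=> on off; rewrite [RHS]mixed_evalE /axis_part /mixed_eval raddf_sum /=.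
rewrite big_mkcond; apply: eq_bigr => m _; rewrite mevalZ.
by case: eqP => [/on|/off]; rewrite /mixed_eval => ->; rewrite ?mulr0.
Qed.

Lemma mixed_eval_axis_u0 f u v :
  mixed_eval (axis_part abscissa f) u v = mixed_eval f 0 v.
Proof.
apply: mixed_eval_axis => m; rewrite !mixed_evalX /abscissa rmorph0.
  by move/eqP; rewrite addn_eq0 => /andP[/eqP -> /eqP ->]; rewrite !expr0.
by move/eqP; rewrite addn_eq0 negb_and => /orP[] /negPf m0;
  rewrite !expr0n m0 ?(mul0r, mulr0).
Qed.

Lemma mixed_eval_axis_v0 f u v :
  mixed_eval (axis_part ordinate f) u v = mixed_eval f u 0.
Proof.
apply: mixed_eval_axis => m; rewrite !mixed_evalX /ordinate rmorph0.
  by move/eqP; rewrite addn_eq0 => /andP[/eqP -> /eqP ->]; rewrite !expr0.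
by move/eqP; rewrite addn_eq0 negb_and => /orP[] /negPf m0;
  rewrite !expr0n m0 ?(mul0r, mulr0).
Qed.

Lemma comp_mpoly_axis_part x (t : 4.-tuple (mixed R)) i j f :
    (forall k, tnth t k = if (k == i) || (k == j) then 0 else 'X_k) ->
    (forall m, x m = m i + m j)%N ->
  f \mPo t = axis_part x f.
Proof.
move=> tE xE; rewrite comp_mpolyEX /axis_part [RHS]big_mkcond.
apply: eq_bigr => m _; rewrite comp_mpolyX.
have -> : (x m == 0%N) = (m i == 0%N) && (m j == 0%N) by rewrite xE addn_eq0.
have zero k : ((k == i) || (k == j)) -> m k != 0%N ->
    f@_m *: \prod_(l < 4) tnth t l ^+ m l = 0.
  move=> kij mk; rewrite (bigD1 k) //= tE kij expr0n (negPf mk) mul0r.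
  exact: scaler0.
case: eqP => [mi|/eqP /(zero i)->]; rewrite ?eqxx //=.
case: eqP => [mj|/eqP /(zero j)->]; rewrite ?eqxx ?orbT //.
congr (_ *: _); rewrite mpolyXE_id; apply: eq_bigr => k _; rewrite tE.
by case: eqP => [->|_]; [|case: eqP => [->|//]]; rewrite /= ?mi ?mj !expr0.
Qed.

Lemma restr_u0E f : restr_u0 f = axis_part abscissa f.
Proof. by apply: (@comp_mpoly_axis_part _ _ iu iub) => // -[[|[|[|[|]]]]]. Qed.

Lemma restr_v0E f : restr_v0 f = axis_part ordinate f.
Proof. by apply: (@comp_mpoly_axis_part _ _ iv ivb) => // -[[|[|[|[|]]]]]. Qed.

(** If the face function of [h] for Q has terms in v alone, these terms make up
    the face function for any P of larger slope; otherwise the value at (0, v)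
    is zero anyway. *)
Lemma face_zero_u0 P Q h u v : positive_weight P -> positive_weight Q -> slope_below Q P ->
  mixed_eval (face_fun P h) u v = 0 -> mixed_eval (face_fun Q h) 0 v = 0.
Proof.
move=> [_ P2] [_ Q2] QP; rewrite -(mixed_eval_axis_u0 _ u).
have [//|//|//|//|//|m mh _ //|->|->//] :=
  @axis_part_face abscissa ordinate P.1 P.2 Q.1 Q.2 P Q h h.
by rewrite /mixed_eval meval0.
Qed.

Lemma face_zero_v0 P Q h u v : positive_weight P -> positive_weight Q -> slope_below P Q ->
  mixed_eval (face_fun P h) u v = 0 -> mixed_eval (face_fun Q h) u 0 = 0.
Proof.
move=> [P1 _] [Q1 _] PQ; rewrite -(mixed_eval_axis_v0 _ u v).
have [m|m|//|//|//|m mh _|->|->//] :=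
  @axis_part_face ordinate abscissa P.2 P.1 Q.2 Q.1 P Q h h.
- exact: addnC.
- exact: addnC.
- by split=> //; rewrite mulnC [X in (_ < X)%N]mulnC.
by rewrite /mixed_eval meval0.
Qed.

Lemma restr_u0_face_zero P Q h u v : positive_weight P -> positive_weight Q ->
  mixed_eval (face_fun P (restr_u0 h)) u v = 0 -> mixed_eval (face_fun Q h) 0 v = 0.
Proof.
move=> [_ P2] [_ Q2]; rewrite -(mixed_eval_axis_u0 _ u) restr_u0E.
have [//|//|//|//|m|m|->|->//] := @axis_part_face abscissa ordinate P.1 P.2 Q.1 Q.2 P Q h
  (axis_part abscissa h).
- by rewrite mcoeff_axis => ->.
- by rewrite mcoeff_msupp mcoeff_axis => /[swap] /eqP/negPf ->; rewrite eqxx.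
by rewrite /mixed_eval meval0.
Qed.

Lemma restr_v0_face_zero P Q h u v : positive_weight P -> positive_weight Q ->
  mixed_eval (face_fun P (restr_v0 h)) u v = 0 -> mixed_eval (face_fun Q h) u 0 = 0.
Proof.
move=> [P1 _] [Q1 _]; rewrite -(mixed_eval_axis_v0 _ u v) restr_v0E.
have [m|m|//|//|m|m|->|->//] := @axis_part_face ordinate abscissa P.2 P.1 Q.2 Q.1 P Q h
  (axis_part ordinate h).
- exact: addnC.
- exact: addnC.
- by rewrite mcoeff_axis => ->.
- by rewrite mcoeff_msupp mcoeff_axis => /[swap] /eqP/negPf ->; rewrite eqxx.
by rewrite /mixed_eval meval0.
Qed.

End Axes.

(** * From common zeros to degenerate points *)

Section Main.
Variable R : realType.
Implicit Types (f g h : mixed R) (P Q : nat * nat) (u v : R[i]).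

(** [z] tells whether a degenerate point must also be a zero of the polynomial:
    true for IND and PND, false for SIND and SPND. *)
Definition degenerate (z : bool) g u v : Prop :=
  if z then mixed_eval g u v = 0 /\ critical g u v else critical g u v.

Definition degeneracy_polys (z : bool) f : seq (mixed R) :=
  [:: s1 f, s2 f, s3 f & if z then [:: f] else [::]].

Lemma degenerate_face z Q f u v :
    (forall h, h \in degeneracy_polys z f -> mixed_eval (face_fun Q h) u v = 0) ->
  degenerate z (face_fun Q f) u v.
Proof.
have tail (x y : mixed R) s : x \in s -> x \in y :: s.
  by rewrite in_cons orbC => ->.
move=> hzero; have crit : critical (face_fun Q f) u v.
  apply: critical_face; apply: hzero.
  - exact: mem_head.
  - exact: tail (mem_head _ _).
  exact: tail (tail _ _ _ (mem_head _ _)).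
rewrite /degenerate; case: z hzero => // hzero; split=> //; apply: hzero.
exact: tail (tail _ _ _ (tail _ _ _ (mem_head _ _))).
Qed.

Definition partially_nondegenerate (z : bool) f : Prop :=
  forall P, positive_weight P -> forall u v, u != 0 -> v != 0 ->
  [/\ ~ common_zero_of_P_parts P (map (@restr_u0 R) (degeneracy_polys z f)) u v,
      ~ common_zero_of_P_parts P (map (@restr_v0 R) (degeneracy_polys z f)) u v &
      ~ common_zero_of_P_parts P (degeneracy_polys z f) u v].

(** Each family of common zeros is turned into a degenerate point of the face
    function that is nondegenerate by the geometric half. *)
Lemma inner_partially_nondegenerate z f : f != 0 ->
  inner_nondegenerate (degenerate z) f -> partially_nondegenerate z f.
Proof.
move=> f0 nd P Ppos u v u0 v0.
have [[Q Qpos Qnd] [Q' Q'pos Q'nd] Pnd] := nondegenerate_faces f0 nd Ppos u0 v0.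
split=> hzero.
- apply: Qnd; apply: degenerate_face => h hin.
  by apply: (restr_u0_face_zero (u := u) Ppos Qpos); apply: hzero; apply: map_f.
- apply: Q'nd; apply: degenerate_face => h hin.
  by apply: (restr_v0_face_zero (v := v) Ppos Q'pos); apply: hzero; apply: map_f.
case: Pnd => [|[S [Spos SP]]|[S [Spos PS]]]; apply; apply: degenerate_face => h hin.
- exact: hzero.
- by apply: (face_zero_u0 (u := u) Ppos Spos SP); apply: hzero.
by apply: (face_zero_v0 (v := v) Ppos Spos PS); apply: hzero.
Qed.

End Main.

Theorem theorem1p1 (R : realType) (f : mixed R) (hf : f != 0)
    (hf0 : mixed_eval f 0 0 = 0) :
  (IND f -> PND f) /\ (SIND f -> SPND f).
Proof.
by split=> nd; [apply: (@inner_partially_nondegenerate R true)|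
                apply: (@inner_partially_nondegenerate R false)].
Qed.
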